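(* Let $m\ge 1$ and $e\in\mathbb{Z}_2^m$. Then $Q_m(e)$ is a connected quandle of size $3\cdot 2^m$ in which the $2^m$ right translations $R_{(0,a)}$ with $a\in\mathbb{Z}_2^m$ are pairwise distinct and pairwise commute.
   Context: For $m\ge 1$ and $e\in\mathbb{Z}_2^m$, $Q_m(e)=(\mathbb{Z}_3\times\mathbb{Z}_2^m,* )$ is defined by $$(i,a)*(j,b)=\begin{cases}(-i-j,\,a),&\text{if } i-j\equiv 0\pmod 3,\\ (-i-j,\,a+b),&\text{if } i-j\equiv 1\pmod 3,\\ (-i-j,\,a+b+e),&\text{if } i-j\equiv 2\pmod 3.\end{cases}$$ In a set with binary operation $*$, the right translation by $x$ is $R_x(y)=y*x$. A quandle is a set with a binary operation such that all right translations are permutations, $(x*y)*z=(x*z)*(y*z)$ and $x*x=x$. A quandle $Q$ is connected if the permutation group $\langle R_x:x\in Q\rangle$ acts transitively on $Q$. *)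

(* Defs.v *)
From HB Require Import structures.
From mathcomp Require Import all_boot all_order all_fingroup all_algebra.
Set Implicit Arguments.
Unset Strict Implicit.
Unset Printing Implicit Defensive.
Import GRing.Theory.
Local Open Scope ring_scope.

Definition rtrans (T : Type) (op : T -> T -> T) (x : T) : T -> T :=
  fun y => op y x.

Definition quandle (T : Type) (op : T -> T -> T) : Prop :=
  [/\ forall x, bijective (rtrans op x),
      forall x y z, op (op x y) z = op (op x z) (op y z)
    & forall x, op x x = x].

(* The generators are the permutations of T that coincide with some right
   translation; in a quandle every right translation is such a permutation. *)
Definition rmlt (T : finType) (op : T -> T -> T) : {group {perm T}} :=
  <<[set s : {perm T} | [exists x, [forall y, s y == rtrans op x y]]]>>%G.

Definition connected_quandle (T : finType) (op : T -> T -> T) : Prop :=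
  quandle op /\ [transitive rmlt op, on [set: T] | 'P].

Definition Qm (m : nat) : finType := ('Z_3 * 'rV['Z_2]_m)%type.

Definition Qm_op (m : nat) (e : 'rV['Z_2]_m) (x y : Qm m) : Qm m :=
  let: (i, a) := x in
  let: (j, b) := y in
  (- i - j,
   if i - j == 0 then a
   else if i - j == 1 then a + b
   else a + b + e).

(* Main.v *)
Require Import Defs.
From HB Require Import structures.
From mathcomp Require Import all_boot all_order all_fingroup all_algebra.
Set Implicit Arguments.
Unset Strict Implicit.
Unset Printing Implicit Defensive.
Import GRing.Theory.
Local Open Scope ring_scope.

(** Write [(i, a) * (j, b) = (- i - j, a + w (i - j) b)] with [w] the twist
    below. Self-distributivity is then a cocycle identity for [w], which is
    checked entrywise, where it only involves finitely many elements of Z_3 and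
    Z_2. Each right translation satisfies [R^2 (i, a) = (i, a + [i <> j] e)], so
    its fourth power is the identity. For connectedness, every element of the
    fibre over [i + 1] is obtained in one step from [(i, 0)], since
    [(i, 0) * (i - 1, b) = (i + 1, b)]. *)

(** Stated over any [nmodType], so that one definition serves both row vectors and their entries in
    ['Z_2]. *)
Definition twist (V : nmodType) (e : V) (d : 'Z_3) (b : V) : V :=
  if d == 0 then 0 else if d == 1 then b else b + e.

Lemma Qm_opE m (e : 'rV['Z_2]_m) (x y : Qm m) :
  Qm_op e x y = (- x.1 - y.1, x.2 + twist e (x.1 - y.1) y.2).
Proof.
case: x y => [i a] [j b]; rewrite /Qm_op /twist; congr (_, _).
by case: ifP => _; [rewrite addr0 | case: ifP => _; rewrite ?addrA].
Qed.

Lemma mxE_twist m (e : 'rV['Z_2]_m) d b k l :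
  twist e d b k l = twist (e k l) d (b k l).
Proof. by rewrite /twist; do 2?case: ifP => _; rewrite ?mxE. Qed.

Lemma twist1 (V : nmodType) (e b : V) : twist e 1 b = b.
Proof. by []. Qed.

Lemma twist_cocycle (e b c : 'Z_2) (i j k : 'Z_3) :
  twist e (i - j) b + twist e (- i - j - k) c =
  twist e (i - k) c + twist e (- i - k - (- j - k)) (b + twist e (j - k) c).
Proof.
by apply/val_inj; case: i j k e b c => [[|[|[|//]]] ?] [[|[|[|//]]] ?]
  [[|[|[|//]]] ?] [[|[|//]] ?] [[|[|//]] ?] [[|[|//]] ?].
Qed.

(** These are the twists picked up in four translations by one [(j, b)], where the difference [d]
    alternates in sign. For [d <> 0] each pair gives [b + (b + e) = e], and [e + e = 0]. *)
Lemma twist_iter4 (e b : 'Z_2) (d : 'Z_3) :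
  twist e d b + (twist e (- d) b + (twist e d b + twist e (- d) b)) = 0.
Proof.
by apply/val_inj; case: d e b => [[|[|[|//]]] ?] [[|[|//]] ?] [[|[|//]] ?].
Qed.

(** Both sides are [a + b + e] for [d <> 0] and vanish for [d = 0]. *)
Lemma twist_commute (e a b : 'Z_2) (d : 'Z_3) :
  twist e d b + twist e (- d) a = twist e d a + twist e (- d) b.
Proof.
by apply/val_inj;
  case: d e a b => [[|[|[|//]]] ?] [[|[|//]] ?] [[|[|//]] ?] [[|[|//]] ?].
Qed.

Lemma Z3_oppB_sub (i j : 'Z_3) : - i - j - j = - (i - j).
Proof.
by apply/val_inj; case: i j => [[|[|[|//]]] ?] [[|[|[|//]]] ?].
Qed.

Lemma rtrans_iter4 m (e : 'rV['Z_2]_m) (x : Qm m) :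
  iter 4 (rtrans (Qm_op e) x) =1 id.
Proof.
case: x => j b [i a]; rewrite /iter /rtrans !Qm_opE /=.
have opp2 (t : 'Z_3) : - (- t - j) - j = t by rewrite opprD !opprK addrK.
rewrite !opp2 !Z3_oppB_sub; congr (_, _); apply/rowP=> l.
by rewrite !(mxE, mxE_twist) -!addrA twist_iter4 addr0.
Qed.

Lemma rtrans_bij m (e : 'rV['Z_2]_m) (x : Qm m) : bijective (rtrans (Qm_op e) x).
Proof. by exists (iter 3 (rtrans (Qm_op e) x)) => y; apply: (rtrans_iter4 e x). Qed.

Lemma Qm_quandle m (e : 'rV['Z_2]_m) : quandle (Qm_op e).
Proof.
split; first exact: rtrans_bij.
- move=> [i a] [j b] [k c]; rewrite !Qm_opE /=; congr (_, _).
    by apply/val_inj; case: i j k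
      => [[|[|[|//]]] ?] [[|[|[|//]]] ?] [[|[|[|//]]] ?].
  apply/rowP=> l; rewrite !(mxE, mxE_twist) -addrA -[RHS]addrA; congr (_ + _).
  exact: twist_cocycle.
- move=> [i a]; rewrite Qm_opE /= subrr /twist eqxx addr0; congr (_, _).
  by apply/val_inj; case: i => [[|[|[|//]]] ?].
Qed.

Lemma orbit_rmlt (T : finType) (op : T -> T -> T) (x y : T) :
  bijective (rtrans op y) -> op x y \in orbit 'P (rmlt op) x.
Proof.
move=> /bij_inj inj_y; apply/orbitP; exists (perm inj_y); last by rewrite /= apermE permE.
apply: mem_gen; rewrite inE; apply/existsP; exists y; apply/forallP => z.
by rewrite permE.
Qed.

Lemma Qm_orbit_step m (e : 'rV['Z_2]_m) (i : 'Z_3) (b : 'rV['Z_2]_m) :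
  ((i + 1, b) : Qm m) \in orbit 'P (rmlt (Qm_op e)) (i, 0).
Proof.
have := orbit_rmlt (i, 0) (rtrans_bij e (i - 1, b)).
rewrite Qm_opE /= subKr add0r twist1.
suff -> : - i - (i - 1) = i + 1 by [].
by apply/val_inj; case: i => [[|[|[|//]]] ?].
Qed.

Lemma Qm_transitive m (e : 'rV['Z_2]_m) :
  [transitive rmlt (Qm_op e), on [set: Qm m] | 'P].
Proof.
apply/imsetP; exists ((0, 0) : Qm m); first by rewrite inE.
apply/esym/setP => -[i b]; rewrite inE.
set O := orbit _ _ _.
have step j c : (j, 0) \in O -> (j + 1, c) \in O.
  by apply/orbit_trans/Qm_orbit_step.
(* The index starts at 1: at the outset only [(0, 0)] is known in the fibre over 0, and the rest of
   that fibre is reached after a full turn. *)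
have reach n c : (n.+1%:R, c) \in O.
  elim: n c => [|n IHn] c; last by rewrite -natr1; apply: step.
  by rewrite -[1%:R]add0r; apply/step/orbit_refl.
(* As a natural number the index is [i + 3], positive and congruent to [i]. *)
suff <- : (i + 2)%N.+1%:R = i by rewrite reach.
by apply/val_inj; case: i => [[|[|[|//]]] ?].
Qed.

Theorem proposition5p20 (m : nat) (hm : (1 <= m)%N) (e : 'rV['Z_2]_m) :
  [/\ connected_quandle (Qm_op e),
      #|Qm m| = (3 * 2 ^ m)%N,
      #|{: 'rV['Z_2]_m}| = (2 ^ m)%N,
      forall a b : 'rV['Z_2]_m, a != b ->
        ~ (rtrans (Qm_op e) (0, a) =1 rtrans (Qm_op e) (0, b))
    & forall a b : 'rV['Z_2]_m,
        rtrans (Qm_op e) (0, a) \o rtrans (Qm_op e) (0, b) =1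
        rtrans (Qm_op e) (0, b) \o rtrans (Qm_op e) (0, a)].
Proof.
have card_rV : #|{: 'rV['Z_2]_m}| = (2 ^ m)%N by rewrite card_mx card_ord mul1n.
split=> //.
- by split; [apply: Qm_quandle | apply: Qm_transitive].
- by rewrite card_prod card_rV card_ord.
(* At [(1, 0)] the difference is 1, so the second coordinate of the image is the translating vector
   itself. *)
- move=> a b /eqP neq_ab /(_ (1, 0)); rewrite /rtrans !Qm_opE /= !subr0 !twist1 !add0r.
  by case.
- move=> a b [i c]; rewrite /comp /rtrans !Qm_opE /= !Z3_oppB_sub.
  congr (_, _); apply/rowP=> l.
  by rewrite !(mxE, mxE_twist) -!addrA twist_commute.
Qed.
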